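(* Let $q\in\mathbb{C}$ with $0<|q|<1$, let $n$ be a positive integer and let $A\in\mathbb{C}^{N\times N}$ be a positive stable matrix. Then the $q$-Bessel matrix polynomial $J_{n,q}(z;A)$ satisfies $$\left[q^{A}z^{2}D_{q}^{2}+\left(\frac{z\big(q^{-nI}+q^{A+(n-1)I}-q^{A-I}-q^{A}\big)-I}{1-q}\right)D_{q}+\frac{(I-q^{-nI})(I-q^{A+(n-1)I})}{(1-q)^{2}}\right]J_{n,q}(z;A)=\mathbf{0}.$$
   Context: Fix a value of $\log q$ and put $q^{M}=e^{M\log q}$ for a square complex matrix $M$; $I$ is the identity matrix and $\mathbf{0}$ the zero matrix. A matrix is positive stable if all its eigenvalues have positive real part. For a square matrix $M$, $(M;q)_0=I$ and $(M;q)_r=\prod_{\tau=0}^{r-1}(I-q^{\tau}M)$; for scalars, $(q;q)_r=\prod_{\tau=1}^{r}(1-q^{\tau})$. The $q$-Bessel matrix polynomials are $$J_{n,q}(z;A)=\frac{(q^{A-I};q)_{n}}{(q;q)_{n}}\sum_{r=0}^{\infty}\frac{(q^{-nI};q)_r(q^{A+(n-1)I};q)_r}{(q;q)_r}z^{r},$$ where the sum is finite since $(q^{-nI};q)_r=\mathbf{0}$ for $r>n$. The $q$-derivative in $z$ is $D_qf(z)=D_{z,q}f(z)=\frac{f(z)-f(qz)}{(1-q)z}$ for $z\neq0$, and $D_qf(0)=f'(0)$; $D_q^2$ is its second iterate. *)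

(* Defs.v *)
From HB Require Import structures.
From mathcomp Require Import all_boot all_order all_algebra.
From mathcomp Require Import all_classical all_reals all_analysis.
From mathcomp Require Export complex.

Set Implicit Arguments.
Unset Strict Implicit.
Unset Printing Implicit Defensive.

Import Order.TTheory GRing.Theory Num.Theory.
Import numFieldNormedType.Exports.

Local Open Scope classical_set_scope.
Local Open Scope ring_scope.

(* The analytic notions are stated over an abstract [K : numFieldType], which   *)
(* carries its norm topology (and ['M[K]_N] the entrywise one); they are meant  *)
(* for [K := R[i]] with [R : realType], i.e. for the complex numbers. This      *)
(* avoids declaring on [R[i]] a normed module structure over itself, which      *)
(* would clash with its canonical [R]-module structure. As [limn] is total, the *)
(* exponentials are meaningful only for complete [K].                           *)
Section QBessel.
Variable K : numFieldType.

Definition scalar_exp (x : K) : K := limn (series (fun k => x ^+ k / k`!%:R)).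

Definition mxexp (N : nat) (M : 'M[K]_N) : 'M[K]_N :=
  limn (series (fun k => k`!%:R^-1 *: M ^+ k)).

(* q ^ M; it depends on the chosen logarithm of q, not only on q *)
Definition qpow (logq : K) (N : nat) (M : 'M[K]_N) : 'M[K]_N :=
  mxexp (logq *: M).

Definition mxqpoch (q : K) (N : nat) (M : 'M[K]_N) (r : nat) : 'M[K]_N :=
  \prod_(0 <= t < r) (1%:M - q ^+ t *: M).

Definition qqpoch (q : K) (r : nat) : K := \prod_(1 <= t < r.+1) (1 - q ^+ t).

Definition qBessel (q logq : K) (N n : nat) (A : 'M[K]_N) (z : K) : 'M[K]_N :=
  ((qqpoch q n)^-1 *: mxqpoch q (qpow logq (A - 1%:M)) n) *m
  limn (series (fun r => (z ^+ r / qqpoch q r) *: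
    (mxqpoch q (qpow logq (- n%:R)%:M) r *m
     mxqpoch q (qpow logq (A + (n%:R - 1)%:M)) r))).

Definition qderive (q : K) (N : nat) (f : K -> 'M[K]_N) (z : K) : 'M[K]_N :=
  if z == 0 then derive1 f 0 else ((1 - q) * z)^-1 *: (f z - f (q * z)).

End QBessel.

Definition positive_stable (R : realType) (N : nat) (A : 'M[R[i]]_N) : Prop :=
  forall a : R[i], eigenvalue A a -> 0 < complex.Re a.

(* Main.v *)
(** Since exp (M + c I) = e^c exp M, the matrices q^(A-I), q^(A+(n-1)I) and
    q^(-nI) are q^-1 P, q^(n-1) P and q^-n I with P = q^A.  Hence J is a
    polynomial with coefficients d_r satisfying
    (1 - q^(r+1)) d_(r+1) = (1 - q^r a) (I - q^r b P) d_r, where a = q^-n and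
    b = q^(n-1), and comparing coefficients of z^r in the equation leaves an
    identity in x = q^r that is affine in P and uses only a b q = 1. *)
Require Import Defs.
From HB Require Import structures.
From mathcomp Require Import all_boot all_order all_algebra.
From mathcomp Require Import all_classical all_reals all_analysis.
From mathcomp Require Import complex ring.

Set Implicit Arguments.
Unset Strict Implicit.
Unset Printing Implicit Defensive.

Import Order.TTheory GRing.Theory Num.Theory.
Import numFieldNormedType.Exports.
Local Open Scope classical_set_scope.
Local Open Scope ring_scope.

(** * Finite series and entrywise convergence *)

(** The partial sums are constant from [m] on. This turns the terminating series in [qBessel] into a
    polynomial. *)
Lemma lim_series_finite (K : numFieldType) (V : normedModType K) (u : nat -> V)
    (m : nat) :
  (forall k, (m <= k)%N -> u k = 0) -> limn (series u) = \sum_(k < m) u k.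
Proof.
move=> u0; apply: norm_lim_near_cst.
near=> k; have mk : (m <= k)%N by near: k; exact: nbhs_infty_ge.
rewrite /series/= (big_cat_nat _ mk)//= big_mkord [X in _ + X]big_nat.
by rewrite [X in _ + X]big1 ?addr0// => i /andP[mi _]; exact: u0.
Unshelve. all: by end_near. Qed.

Lemma cvg_mx (K : numFieldType) (m n : nat) (u : nat -> 'M[K]_(m, n))
    (L : 'M[K]_(m, n)) :
  (forall i j, (fun k => u k i j) @ \oo --> L i j) -> u @ \oo --> L.
Proof.
move=> uL; apply/cvg_ballP => e e0.
suff : \forall k \near \oo, forall i j, ball (L i j) e (u k i j).
  by apply: filterS.
apply: filter_forall => i; apply: filter_forall => j.
by move/cvg_ballP : (uL i j); apply.
Qed.

(** * The q-derivative of matrix-valued polynomials *)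

Section qdifference_polynomials.
Variables (K : numFieldType) (N : nat).
Implicit Types (c : nat -> 'M[K]_N) (q z : K).

(** The two boundary terms vanish, so reindexing keeps the range [m] and coefficients of different
    sums can be compared directly. *)
Lemma sumr_shift c (m : nat) z : c 0 = 0 -> c m = 0 ->
  \sum_(r < m) z ^+ r.+1 *: c r.+1 = \sum_(r < m) z ^+ r *: c r.
Proof.
move=> c0 cm; case: m cm => [|m] cm; first by rewrite !big_ord0.
by rewrite big_ord_recr big_ord_recl /= c0 cm !scaler0 add0r addr0.
Qed.

Lemma derive1_sumZ_at0 c (m : nat) : (forall r, (m <= r)%N -> c r = 0) ->
  derive1 (fun z => \sum_(r < m) z ^+ r *: c r) 0 = c 1.
Proof.
case: m => [|m] cm; rewrite /derive1.
  apply: cvg_lim; first exact: norm_hausdorff.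
  under eq_fun do rewrite !big_ord0 subrr scaler0.
  by rewrite cm//; exact: cvg_cst.
apply: cvg_lim; first exact: norm_hausdorff.
(* For [h != 0] the difference quotient is itself a polynomial in [h]; its formal top coefficient
   [c m.+1] is zero. Continuity then gives the limit. *)
apply: (@cvg_trans _ ((fun h : K => \sum_(r < m.+1) h ^+ r *: c r.+1) @ 0^')).
  apply: near_eq_cvg; near=> h.
  have h0 : h != 0 by near: h; exact: nbhs_dnbhs_neq.
  rewrite addr0 [in LHS]big_ord_recr /= cm// scaler0 addr0.
  rewrite !big_ord_recl /= [X in _ - (_ + X)]big1 ?addr0; last first.
    by move=> i _; rewrite expr0n scale0r.
  rewrite !expr0 [1 *: c 0 + _]addrC addrK.
  by rewrite scaler_sumr; apply: eq_bigr => i _; rewrite scalerA exprS mulKf.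
have -> : c 1 = \sum_(r < m.+1) (0 : K) ^+ r *: c r.+1.
  rewrite big_ord_recl /= expr0 scale1r big1 ?addr0// => i _.
  by rewrite expr0n scale0r.
apply: cvg_big => [|r _]; first exact: add_continuous.
apply: cvgZr_tmp; apply: cvg_within_filter.
elim: (r : nat) => [|k IHk]; first exact: cvg_cst.
by under eq_fun do rewrite exprS; rewrite exprS; apply: cvgM => //; exact: cvg_id.
Unshelve. all: by end_near. Qed.

(** Each [z ^+ r] is sent to a q-number times [z ^+ r.-1]; at [0] only [c 1] survives, with factor
    1, which matches the ordinary derivative. The range stays [m] so that the rule can be
    iterated. *)
Lemma qderive_sumZ q c (m : nat) : q != 1 -> (forall r, (m <= r)%N -> c r = 0) ->
  qderive q (fun z => \sum_(r < m) z ^+ r *: c r) =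
  (fun z => \sum_(r < m) z ^+ r *: (((1 - q ^+ r.+1) / (1 - q)) *: c r.+1)).
Proof.
move=> q1 cm; have q1' : 1 - q != 0 by rewrite subr_eq0 eq_sym.
apply/funext => z; rewrite /qderive; case: eqVneq => [->|z0].
  rewrite derive1_sumZ_at0//; case: m cm => [|m] cm; first by rewrite big_ord0 cm.
  rewrite big_ord_recl /= expr0 expr1 divff// !scale1r big1 ?addr0// => i _.
  by rewrite expr0n scale0r.
apply: (scalerI z0); rewrite scaler_sumr -sumrB.
under [RHS]eq_bigr do rewrite scalerA -exprS.
rewrite (@sumr_shift (fun r => ((1 - q ^+ r) / (1 - q)) *: c r)).
- rewrite !scaler_sumr; apply: eq_bigr => i _.
  rewrite exprMn -scalerBl !scalerA; congr (_ *: _); field.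
  by rewrite q1' z0.
- by rewrite expr0 subrr mul0r scale0r.
- by rewrite cm// scaler0.
Qed.

End qdifference_polynomials.

(** * Dominated convergence of complex and matrix series *)

Lemma mx_norm_entry (K : numDomainType) (m n : nat) (A : 'M[K]_(m, n)) i j :
  `|A i j| <= `|A|.
Proof.
rewrite [leRHS]/Num.norm /= mx_normE -[leLHS]nngE num_le.
exact: (@le_bigmax _ _ _ _ (fun ij : 'I_m * 'I_n => `|A ij.1 ij.2|%:nng) (i, j)).
Qed.

Section complex_series.
Variable R : realType.
Local Notation C := (R[i] : numFieldType).

Lemma cvg_real_complex (u : nat -> R) (l : R) : u @ \oo --> l ->
  (fun k => (u k)%:C%C : C) @ \oo --> (l%:C%C : C).
Proof.
(* In the order of [R[i]] a positive radius has zero imaginary part, so it is a positive real. *)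
move=> ul; apply/cvgrPdist_lt => -[e ei]; rewrite ltcE/= => /andP[/eqP-> e0].
have /cvgrPdist_lt /(_ _ e0) := ul.
apply: filterS => k.
by rewrite -rmorphB normc_def /= expr0n/= addr0 sqrtr_sqr ltcR.
Qed.

(** The real and imaginary parts are bounded by the modulus, so both converge absolutely by
    comparison in [R]. *)
Lemma cvgn_seriesC (u : nat -> C) (b : nat -> R) :
  (forall k, `|u k| <= (b k)%:C%C) -> cvgn (series b) -> cvgn (series u).
Proof.
move=> ub cb.
have cpart (p : {additive R[i] -> R}) :
    (forall z, `|p z|%:C%C <= `|z|) -> cvgn (series (p \o u)).
  move=> ple; apply: normed_cvg; apply: (series_le_cvg _ _ _ cb) => // k /=.
  - exact: normr_ge0.
  - by rewrite -lecR; apply: le_trans (ub k); exact: normr_ge0.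
  - by rewrite -lecR; apply: le_trans (ub k); exact: ple.
have /cvg_ex[a ca] : cvgn (series (@complex.Re R \o u)).
  exact: (cpart (@complex.Re R)) (@normc_ge_Re R).
have /cvg_ex[c cc] : cvgn (series (@complex.Im R \o u)).
  apply: (cpart (@complex.Im R)) => z; rewrite normc_def lecR -sqrtr_sqr ler_wsqrtr//.
  by rewrite lerDr sqr_ge0.
apply/cvg_ex; exists (a%:C%C + 'i%C * c%:C%C).
suff -> : series u = (fun k => (series (@complex.Re R \o u) k)%:C%C +
                       'i%C * (series (@complex.Im R \o u) k)%:C%C).
  apply: cvgD; first exact: cvg_real_complex.
  by apply: cvgM; [exact: cvg_cst|exact: cvg_real_complex].
apply/funext => k; rewrite /series /= !rmorph_sum mulr_sumr -big_split/=.
by apply: eq_bigr => i _; exact: complexE.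
Qed.

Lemma cvgn_series_mx (m n : nat) (u : nat -> 'M[C]_(m, n)) (b : nat -> R) :
  (forall k, `|u k| <= (b k)%:C%C) -> cvgn (series b) -> cvgn (series u).
Proof.
move=> ub cb.
have cu i j : cvgn (series (fun k => u k i j)).
  apply: cvgn_seriesC cb => k; apply: le_trans (ub k).
  exact: mx_norm_entry.
apply/cvg_ex; exists (\matrix_(i, j) limn (series (fun k => u k i j))).
apply: cvg_mx => i j; rewrite mxE.
rewrite (_ : (fun k => _) = series (fun k => u k i j)); first exact: cu.
by apply/funext => k; rewrite /series /= summxE.
Qed.

End complex_series.

(** * Cauchy products and norms of matrix powers *)

Lemma sumr_square_triangle (V : zmodType) (F : nat -> nat -> V) (n : nat) :
  \sum_(i < n) \sum_(j < n) F i j =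
  \sum_(k < n) \sum_(i < k.+1) F i (k - i)%N +
  \sum_(i < n) \sum_(n - i <= j < n) F i j.
Proof.
have -> : \sum_(k < n) \sum_(i < k.+1) F i (k - i)%N =
    \sum_(i < n) \sum_(0 <= j < n - i) F i j.
  (* The new antidiagonal [i + j = n] appends one term to each row. *)
  elim: n => [|n IHn]; first by rewrite !big_ord0.
  rewrite big_ord_recr /= IHn [RHS]big_ord_recr big_ord_recr /= subSnn subnn.
  rewrite big_nat1 addrA -big_split /=; congr (_ + _).
  by apply: eq_bigr => i _; rewrite subSn 1?ltnW// big_nat_recr.
rewrite -big_split /=; apply: eq_bigr => i _.
by rewrite -(big_mkord xpredT (F i)) (big_cat_nat (leq0n (n - i)) (leq_subr _ _)).
Qed.

(** The norm is the maximum of the entries, and an entry of the product is a sum of [n] products;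
    hence the factor [n]. *)
Lemma norm_mulmx_le (K : numDomainType) (m n p : nat) (A : 'M[K]_(m, n))
    (B : 'M[K]_(n, p)) :
  `|A *m B| <= n%:R * `|A| * `|B|.
Proof.
have [->|/mx_norm_neq0[[i j]]] := eqVneq `|A *m B| 0.
  by rewrite !mulr_ge0// ?normr_ge0// ler0n.
rewrite -[mx_norm _]/(`|A *m B|) => -> /=; rewrite mxE.
apply: le_trans (ler_norm_sum _ _ _) _.
rewrite -mulrA -[X in X%:R * _](card_ord n) mulr_natl -sumr_const.
by apply: ler_sum => k _; rewrite normrM ler_pM// mx_norm_entry.
Qed.

Lemma norm_expmx_le (K : numDomainType) (N : nat) (M : 'M[K]_N) (k : nat) :
  `|M ^+ k| <= (N%:R * `|M|) ^+ k.
Proof.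
elim: k => [|k IHk].
  have [->|/mx_norm_neq0[[i j]]] := eqVneq `|M ^+ 0| 0; first by rewrite expr0.
  rewrite -[mx_norm _]/(`|M ^+ 0|) => -> /=; rewrite !expr0 mxE.
  by case: eqP; rewrite ?normr0 ?normr1.
rewrite !exprS; apply: (le_trans (norm_mulmx_le M (M ^+ k))).
by rewrite ler_wpM2l// mulr_ge0.
Qed.

(** * The matrix exponential and scalar shifts *)

Section matrix_exponential.
Variable R : realType.
Local Notation C := (R[i] : numFieldType).

Lemma ge0_real_complex (x : C) : 0 <= x -> x = (complex.Re x)%:C%C.
Proof. by case: x => a b; rewrite lecE /= => /andP[/eqP-> _]. Qed.

Lemma norm_exp_coeffC (c : C) (k : nat) :
  `|c ^+ k / k`!%:R| = (exp_coeff (complex.Re `|c|) k)%:C%C.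
Proof.
rewrite normrM normfV normrX normr_nat [in LHS](ge0_real_complex (normr_ge0 c)).
by rewrite /exp_coeff /= rmorphM rmorphXn fmorphV rmorph_nat.
Qed.

Lemma norm_expmx_coeff (N : nat) (M : 'M[C]_N) (k : nat) :
  `|k`!%:R^-1 *: M ^+ k| <= (exp_coeff (N%:R * complex.Re `|M|) k)%:C%C.
Proof.
rewrite mx_normZ normfV normr_nat mulrC /exp_coeff /= rmorphM fmorphV rmorph_nat.
rewrite ler_wpM2r ?invr_ge0 ?ler0n// (le_trans (norm_expmx_le _ _))//.
rewrite rmorphXn rmorphM rmorph_nat.
by rewrite [in leLHS](ge0_real_complex (normr_ge0 M)).
Qed.

Lemma cvgn_scalar_exp (c : C) : cvgn (series (fun k => c ^+ k / k`!%:R)).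
Proof.
apply: cvgn_seriesC (is_cvg_series_exp_coeff (complex.Re `|c|)) => k.
by rewrite norm_exp_coeffC.
Qed.

Lemma cvgn_mxexp (N : nat) (M : 'M[C]_N) :
  cvgn (series (fun k => k`!%:R^-1 *: M ^+ k)).
Proof.
apply: cvgn_series_mx (is_cvg_series_exp_coeff (N%:R * complex.Re `|M|)) => k.
exact: norm_expmx_coeff.
Qed.

(** A scalar matrix commutes with [M], so the binomial theorem applies and gives an antidiagonal of
    the Cauchy product. *)
Lemma expmx_coeffD (N : nat) (M : 'M[C]_N) (c : C) (k : nat) :
  k`!%:R^-1 *: (M + c%:M) ^+ k =
  \sum_(i < k.+1) (c ^+ (k - i) / (k - i)`!%:R) *: (i`!%:R^-1 *: M ^+ i).
Proof.
rewrite addrC exprDn_comm; last exact: comm_scalar_mx.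
rewrite scaler_sumr; apply: eq_bigr => -[i /= ik] _.
have -> : c%:M ^+ (k - i) = (c ^+ (k - i))%:M :> 'M[C]_N.
  elim: (k - i)%N => [|j IHj]; first by rewrite !expr0.
  by rewrite !exprS IHj [RHS]scalar_mxM.
rewrite [_%:M * _]mul_scalar_mx -[_ *: _ *+ _]scaler_nat !scalerA; congr (_ *: _).
have <- : 'C(k, i)%:R * (i`!%:R * (k - i)`!%:R) = k`!%:R :> C.
  by rewrite -!natrM bin_fact.
have nz j : (j`!%:R : C) != 0 by rewrite pnatr_eq0 -lt0n fact_gt0.
have bz : ('C(k, i)%:R : C) != 0 by rewrite pnatr_eq0 -lt0n bin_gt0.
by field; rewrite !nz bz.
Qed.

Lemma exp_coeffD (x y : R) (k : nat) :
  exp_coeff (x + y) k =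
  \sum_(i < k.+1) exp_coeff y (k - i)%N * exp_coeff x i.
Proof.
rewrite /exp_coeff /= addrC exprDn mulr_suml; apply: eq_bigr => -[i /= ik] _.
have <- : 'C(k, i)%:R * (i`!%:R * (k - i)`!%:R) = k`!%:R :> R.
  by rewrite -!natrM bin_fact.
have nz j : (j`!%:R : R) != 0 by rewrite pnatr_eq0 -lt0n fact_gt0.
have bz : ('C(k, i)%:R : R) != 0 by rewrite pnatr_eq0 -lt0n bin_gt0.
by rewrite -[_ * _ *+ _]mulr_natr; field; rewrite !nz bz.
Qed.

(* The square partial sums of the Cauchy product differ from the triangular ones
   by at most the same difference [d n] for real exponentials, and [d n] tends to
   [0] because the real exponential is already known to be multiplicative. *)
Lemma mxexpD_scalar (N : nat) (M : 'M[C]_N) (c : C) :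
  mxexp (M + c%:M) = scalar_exp c *: mxexp M.
Proof.
(* The factor [N] in [x] comes from the bound on powers in the entrywise norm. *)
pose x := N%:R * complex.Re `|M|; pose y := complex.Re `|c|.
pose e (X : 'M[C]_N) := series (fun k => k`!%:R^-1 *: X ^+ k).
pose s := series (fun k => c ^+ k / k`!%:R).
pose d n := series (exp_coeff y) n * series (exp_coeff x) n -
            series (exp_coeff (x + y)) n.
have d0 : (fun n => (d n)%:C%C : C) @ \oo --> (0 : C).
  apply: cvg_real_complex.
  have <- : expR y * expR x - expR (x + y) = 0 by rewrite expRD mulrC subrr.
  by apply: cvgB; [apply: cvgM|]; exact: is_cvg_series_exp_coeff.
have serE (V : zmodType) (u : nat -> V) n : series u n = \sum_(i < n) u i.
  by rewrite /series /= big_mkord.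
have le_d n : `|s n *: e M n - e (M + c%:M) n| <= (d n)%:C%C.
  have -> : s n *: e M n - e (M + c%:M) n =
      \sum_(i < n) \sum_(n - i <= j < n)
        (c ^+ j / j`!%:R) *: (i`!%:R^-1 *: M ^+ i).
    rewrite /s /e !serE scaler_sumr; under eq_bigr do rewrite scaler_suml.
    rewrite (sumr_square_triangle
      (fun i j => (c ^+ j / j`!%:R) *: (i`!%:R^-1 *: M ^+ i))).
    by under [in X in _ - X]eq_bigr do rewrite expmx_coeffD; rewrite addrC addKr.
  have -> : d n = \sum_(i < n) \sum_(n - i <= j < n) exp_coeff y j * exp_coeff x i.
    rewrite /d !serE mulr_sumr; under eq_bigr do rewrite mulr_suml.
    rewrite (sumr_square_triangle (fun i j => exp_coeff y j * exp_coeff x i)).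
    by under [in X in _ - X]eq_bigr do rewrite exp_coeffD; rewrite addrC addKr.
  rewrite rmorph_sum; apply: le_trans (ler_norm_sum _ _ _) _.
  apply: ler_sum => i _; rewrite rmorph_sum; apply: le_trans (ler_norm_sum _ _ _) _.
  apply: ler_sum => j _; rewrite normrZ norm_exp_coeffC [leRHS]rmorphM.
  apply: ler_wpM2l; last exact: norm_expmx_coeff.
  by rewrite -norm_exp_coeffC.
have de0 : (fun n => s n *: e M n - e (M + c%:M) n) @ \oo --> (0 : 'M[C]_N).
  apply/cvgr0Pnorm_lt => eps eps0.
  have /cvgr0Pnorm_lt /(_ _ eps0) := d0; apply: filterS => n.
  apply: le_lt_trans; apply: le_trans (le_d n) _; apply: real_ler_norm.
  by apply: ger0_real; apply: le_trans (le_d n); exact: normr_ge0.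
have sM : (fun n => s n *: e M n) @ \oo --> scalar_exp c *: mxexp M.
  by apply: cvgZ; [exact: cvgn_scalar_exp|exact: cvgn_mxexp].
apply: cvg_lim; first exact: norm_hausdorff.
rewrite -[X in _ --> X]subr0.
apply: cvg_trans (cvgB sM de0); apply: near_eq_cvg; near=> n.
by rewrite /= opprB addrCA subrr addr0.
Unshelve. all: by end_near. Qed.

End matrix_exponential.

Lemma mxexp0 (K : numFieldType) (N : nat) : mxexp (0 : 'M[K]_N) = 1%:M.
Proof.
rewrite /mxexp (@lim_series_finite _ _ _ 1) ?big_ord1 ?expr0 ?fact0 ?invr1 ?scale1r//.
by case=> // k _; rewrite exprS [0 * _]mul0mx scaler0.
Qed.

Lemma qpowD1 (R : realType) (N : nat) (l : (R[i] : numFieldType))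
    (M : 'M[(R[i] : numFieldType)]_N) :
  qpow l (M + 1%:M) = scalar_exp l *: qpow l M.
Proof. by rewrite /qpow scalerDr scale_scalar_mx mulr1 mxexpD_scalar. Qed.

(** * Coefficient recurrence and the q-difference equation *)

Section qBessel_equation.
Variables (K : numFieldType) (N : nat).
Implicit Types (q a b l z : K) (A P M : 'M[K]_N) (d : nat -> 'M[K]_N).

Lemma mxqpochS q M r :
  mxqpoch q M r.+1 = mxqpoch q M r *m (1%:M - q ^+ r *: M).
Proof. by rewrite /mxqpoch big_nat_recr. Qed.

Lemma qqpochS q r : qqpoch q r.+1 = qqpoch q r * (1 - q ^+ r.+1).
Proof. by rewrite /qqpoch big_nat_recr. Qed.

Lemma comm_mx_scale P M c : comm_mx P M -> comm_mx P (c *: M).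
Proof. by rewrite /comm_mx -scalemxAr -scalemxAl => ->. Qed.

Lemma comm_mxqpoch q M P r : comm_mx P M -> comm_mx P (mxqpoch q M r).
Proof.
move=> PM; elim: r => [|r IHr]; first by rewrite /mxqpoch big_geq//; exact: comm_mx1.
rewrite mxqpochS; apply: comm_mxM => //; apply: comm_mxB; first exact: comm_mx1.
exact: comm_mx_scale.
Qed.

Lemma qdifference_equation q a b P d (m : nat) z :
  (forall r, q ^+ r.+1 != 1) -> q != 0 -> a * b * q = 1 ->
  (forall r, (m <= r)%N -> d r = 0) ->
  (forall r, d r.+1 = ((1 - q ^+ r * a) / (1 - q ^+ r.+1)) *:
                      ((1%:M - (q ^+ r * b) *: P) *m d r)) ->
  let J := fun z => \sum_(r < m) z ^+ r *: d r in
  (z ^+ 2 *: P) *m qderive q (qderive q J) z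
  + ((1 - q)^-1 *: (z *: (a%:M + b *: P - q^-1 *: P - P) - 1%:M)) *m qderive q J z
  + ((1 - q) ^- 2 *: ((1%:M - a%:M) *m (1%:M - b *: P))) *m J z = 0.
Proof.
move=> qr1 q0 abq dm dS J; have q1 := qr1 0; rewrite expr1 in q1.
have q1' : 1 - q != 0 by rewrite subr_eq0 eq_sym.
(* [f] and [e] are the coefficients of [z D_q J] and [z^2 D_q^2 J]. Writing [q ^+ r / q] for the
   power [r - 1] avoids truncated subtraction at [r = 0]. *)
pose f r := ((1 - q ^+ r) / (1 - q)) *: d r.
pose e r := ((1 - q ^+ r) / (1 - q)) * ((1 - q ^+ r / q) / (1 - q)) *: d r.
have f0 : f 0 = 0 by rewrite /f expr0 subrr mul0r scale0r.
have fm r : (m <= r)%N -> f r = 0 by move=> mr; rewrite /f dm// scaler0.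
have e0 : e 0 = 0 by rewrite /e expr0 subrr !mul0r scale0r.
have e1 : e 1 = 0 by rewrite /e expr1 !divff// subrr mul0r mulr0 scale0r.
have em r : (m <= r)%N -> e r = 0 by move=> mr; rewrite /e dm// scaler0.
have D1 : qderive q J = fun z => \sum_(r < m) z ^+ r *: f r.+1.
  exact: qderive_sumZ.
have zD1 : z *: qderive q J z = \sum_(r < m) z ^+ r *: f r.
  rewrite D1 scaler_sumr -(sumr_shift _ f0 (fm _ _))//.
  by apply: eq_bigr => r _; rewrite scalerA exprS.
have zD2 : z ^+ 2 *: qderive q (qderive q J) z = \sum_(r < m) z ^+ r *: e r.
  rewrite D1 (qderive_sumZ (c := fun r => f r.+1) q1); last first.
    by move=> r mr; rewrite fm// leqW.
  rewrite scaler_sumr -(sumr_shift _ e0 (em _ _))//.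
  under [RHS]eq_bigr do rewrite exprSr -scalerA.
  (* The second shift is allowed because [e 1 = 0]. *)
  rewrite -(@sumr_shift _ _ (fun r => z *: e r.+1)) ?e1 ?em ?scaler0//.
  apply: eq_bigr => r _; rewrite /e /f !scalerA; congr (_ *: _).
  rewrite !exprS; field.
  by rewrite q0 q1'.
set B := a%:M + b *: P - q^-1 *: P - P; set E := (1 - q) ^- 2 *: _.
have -> : ((1 - q)^-1 *: (z *: B - 1%:M)) *m qderive q J z =
    (1 - q)^-1 *: (B *m (z *: qderive q J z) - qderive q J z).
  by rewrite -scalemxAl mulmxBl mul1mx -scalemxAl scalemxAr.
rewrite -scalemxAl scalemxAr zD2 zD1 D1 /J !mulmx_sumr -sumrB scaler_sumr.
rewrite -!big_split /= big1// => r _.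
rewrite -!scalemxAr -scalerBr [(1 - q)^-1 *: _]scalerA [(1 - q)^-1 * _]mulrC.
rewrite -[(z ^+ r * _) *: _]scalerA -!scalerDr.
rewrite [X in _ *: X](_ : _ = 0) ?scaler0// /f dS.
rewrite /E -scalemxAl -mulmxA /B.
rewrite !mulmxBl !mulmxDl !mul1mx !mul_scalar_mx -!scalemxAl.
(* The coefficient is linear in [d r] and [P *m d r], which may be treated as independent. *)
move: (P *m d r) => Y; move: (d r) => X; apply/matrixP => i j; rewrite !mxE.
have q1r : 1 - q ^+ r.+1 != 0 by rewrite subr_eq0 eq_sym.
(* After this substitution the identity holds for free [a], [b] and [q ^+ r]. *)
have -> : q^-1 = a * b by apply: (mulIf q0); rewrite mulVf.
move: q1r; rewrite exprS => q1r.
by field; rewrite q1r q1'.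
Qed.

(** The factor of index [n] is [I - q^n q^-n I = 0]. *)
Lemma mxqpoch_scalar_eq0 q (n r : nat) : q != 0 -> (n < r)%N ->
  mxqpoch q (q ^- n)%:M r = 0 :> 'M[K]_N.
Proof.
move=> q0; elim: r => // r IHr; rewrite ltnS leq_eqVlt mxqpochS => /predU1P[<-|nr].
  by rewrite scale_scalar_mx divff ?expf_neq0// subrr mulmx0.
by rewrite IHr// mul0mx.
Qed.

Lemma qBessel_sum q l (n : nat) A : q != 0 ->
  qpow l (- n%:R)%:M = (q ^- n)%:M :> 'M[K]_N ->
  qBessel q l n A = fun z => \sum_(r < n.+1) z ^+ r *:
    (((qqpoch q n)^-1 *: mxqpoch q (qpow l (A - 1%:M)) n) *m
     ((qqpoch q r)^-1 *: (mxqpoch q (q ^- n)%:M r *m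
                          mxqpoch q (qpow l (A + (n%:R - 1)%:M)) r))).
Proof.
move=> q0 ln; apply/funext => z.
rewrite /qBessel ln (@lim_series_finite _ _ _ n.+1) => [|r nr]; last first.
  by rewrite mxqpoch_scalar_eq0// mul0mx scaler0.
rewrite mulmx_sumr; apply: eq_bigr => r _.
by rewrite -scalerA -scalemxAr.
Qed.

(** The exponential enters through the rule [q^(M+I) = q q^M] and its value at [0]; the rule is
    therefore taken as a hypothesis, over any [K]. *)
Lemma qBessel_equation q l (n : nat) A z :
  0 < `|q| -> `|q| < 1 ->
  (forall M, qpow l (M + 1%:M) = q *: qpow l M) ->
  let J := qBessel q l n A in
  let qA := qpow l A in
  let qA1 := qpow l (A - 1%:M) in
  let qn := qpow l (- n%:R)%:M in
  let qAn := qpow l (A + (n%:R - 1)%:M) in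
  (z ^+ 2 *: qA) *m qderive q (qderive q J) z
  + ((1 - q)^-1 *: (z *: (qn + qAn - qA1 - qA) - 1%:M)) *m qderive q J z
  + ((1 - q) ^- 2 *: ((1%:M - qn) *m (1%:M - qAn))) *m J z = 0.
Proof.
move=> q_gt0 q_lt1 qpowD1; have q0 : q != 0 by rewrite -normr_gt0.
have qr1 r : q ^+ r.+1 != 1.
  apply: contraTneq q_lt1 => qr; rewrite -(@expr_lt1 _ r.+1)//.
  by rewrite -normrX qr normr1 ltxx.
have qpowDn M k : qpow l (M + k%:R%:M) = q ^+ k *: qpow l M.
  elim: k => [|k IHk]; first by rewrite raddf0 addr0 expr0 scale1r.
  by rewrite -addn1 natrD raddfD addrA qpowD1 IHk scalerA -exprS addn1.
have qpowB1 M : qpow l (M - 1%:M) = q^-1 *: qpow l M.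
  by rewrite -{2}(subrK 1%:M M) qpowD1 scalerA mulVf ?scale1r.
have qAn1 : qpow l (A + (n%:R - 1)%:M) = (q ^+ n / q) *: qpow l A.
  by rewrite raddfB addrA qpowB1 qpowDn scalerA mulrC.
(* Climbing [n] unit steps from [-n I] reaches the zero matrix, whose exponential is [I]. *)
have qn : qpow l (- n%:R)%:M = (q ^- n)%:M :> 'M[K]_N.
  apply: (scalerI (expf_neq0 n q0)); rewrite -qpowDn -raddfD addNr raddf0.
  by rewrite /qpow scaler0 mxexp0 scale_scalar_mx divff ?expf_neq0.
pose d r := ((qqpoch q n)^-1 *: mxqpoch q (qpow l (A - 1%:M)) n) *m
  ((qqpoch q r)^-1 *: (mxqpoch q (q ^- n)%:M r *m
                       mxqpoch q (qpow l (A + (n%:R - 1)%:M)) r)).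
have JE : qBessel q l n A = fun z => \sum_(r < n.+1) z ^+ r *: d r.
  exact: qBessel_sum.
rewrite /= JE qn qAn1 qpowB1.
apply: (@qdifference_equation q _ _ (qpow l A) d n.+1 z qr1 q0).
- by rewrite mulrA mulVf ?expf_neq0// mul1r mulVf.
- by move=> r nr; rewrite /d mxqpoch_scalar_eq0// mul0mx scaler0 mulmx0.
move=> r; rewrite /d qAn1 qpowB1; set P := qpow l A; set b := q ^+ n / q.
set T := 1%:M - (q ^+ r * b) *: P.
have commT M k : comm_mx P M -> comm_mx T (mxqpoch q M k).
  move=> PM; apply: comm_mx_sym; apply: comm_mxB; first exact: comm_mx1.
  by apply: comm_mx_scale; apply: comm_mx_sym; exact: comm_mxqpoch.
have commPZ c : comm_mx P (c *: P) by apply: comm_mx_scale; exact: comm_mx_refl.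
(* [T] is the factor of index [r] of the last Pochhammer product. The recurrence has it on the far
   left, [mxqpochS] on the right; it can be moved across since all factors are polynomials in
   [P]. *)
have -> (X Y Z : 'M[K]_N) c c' : comm_mx T X -> comm_mx T Y -> comm_mx T Z ->
    T *m ((c *: X) *m (c' *: (Y *m Z))) = (c *: X) *m (c' *: (Y *m (Z *m T))).
  move=> TX TY TZ; rewrite -!scalemxAl -!scalemxAr; congr (_ *: (_ *: _)).
  by rewrite mulmxA TX -mulmxA (mulmxA T) TY -(mulmxA Y) TZ.
- rewrite !mxqpochS scale_scalar_mx -raddfB mul_mx_scalar scalerA -/T.
  rewrite -!scalemxAl -!scalemxAr !scalerA; congr (_ *: _).
  by rewrite qqpochS invfM; ring.
- exact: commT.
- by apply: commT; exact: comm_mx_scalar.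
- exact: commT.
Qed.

End qBessel_equation.

Theorem theorem2p2 (R : realType) (q logq : R[i]) (N n : nat) (A : 'M[R[i]]_N)
    (q_exp : scalar_exp logq = q) (q_gt0 : 0 < `|q|) (q_lt1 : `|q| < 1)
    (n_gt0 : (0 < n)%N) (A_stable : positive_stable A) (z : R[i]) :
  let J := qBessel q logq n A in
  let qA := qpow logq A in
  let qA1 := qpow logq (A - 1%:M) in
  let qn := qpow logq (- n%:R)%:M in
  let qAn := qpow logq (A + (n%:R - 1)%:M) in
  (z ^+ 2 *: qA) *m qderive q (qderive q J) z
  + ((1 - q)^-1 *: (z *: (qn + qAn - qA1 - qA) - 1%:M)) *m qderive q J z
  + ((1 - q) ^- 2 *: ((1%:M - qn) *m (1%:M - qAn))) *m J z = 0.
Proof.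
by apply: qBessel_equation => // M; rewrite qpowD1 q_exp.
Qed.
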